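(* Let $l\ge2$ and $q=1(l+1)l\ldots2$. There are infinitely many positive integers $n$ such that the sequence $(S_{n,q}(c))_{c\ge0}$ has an internal zero.
   Context: $q=1(l+1)l\ldots2$ is the permutation of length $l+1$ with first entry $1$ followed by $l+1,l,\ldots,2$. For $p\in S_n$, $c_q(p)$ is the number of subsequences of $p$ of length $l+1$ in the same relative order as $q$; $S_{n,q}(c)$ is the number of $p\in S_n$ with $c_q(p)=c$. An integer $c$ is an internal zero if $S_{n,q}(c)=0$ but there are $c_1<c<c_2$ with $S_{n,q}(c_1),S_{n,q}(c_2)\ne0$. *)

(* Defs.v *)
From mathcomp Require Import all_boot all_fingroup.

Set Implicit Arguments.
Unset Strict Implicit.
Unset Printing Implicit Defensive.

(* A permutation p : 'S_n is read in one-line notation, zero-indexed: the entry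
   at position i < n is p i < n.  A subsequence of length k is given by its
   strictly increasing position function f : 'I_k -> 'I_n. *)
Definition occurrence (k n : nat) (q : 'S_k) (p : 'S_n)
    (f : {ffun 'I_k -> 'I_n}) : bool :=
  [forall i : 'I_k, forall j : 'I_k, (i < j) ==> (f i < f j)] &&
  [forall i : 'I_k, forall j : 'I_k, (p (f i) < p (f j)) == (q i < q j)].

Definition copies (k n : nat) (q : 'S_k) (p : 'S_n) : nat :=
  #|[set f : {ffun 'I_k -> 'I_n} | occurrence q p f]|.

Definition freq (k n : nat) (q : 'S_k) (c : nat) : nat :=
  #|[set p : 'S_n | copies q p == c]|.

Definition internal_zero (a : nat -> nat) (c : nat) : Prop :=
  a c = 0 /\ exists c1 c2 : nat, c1 < c < c2 /\ a c1 <> 0 /\ a c2 <> 0.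

(* The pattern 1 (l+1) l ... 2, of length l+1: it fixes the first position and
   reverses the remaining l entries. *)
Definition pattern1rev (l : nat) : 'S_l.+1 :=
  lift_perm ord0 ord0 (perm (@rev_ord_inj l)).

Lemma pattern1revE (l : nat) (i : 'I_l.+1) :
  pattern1rev l i = (if i == 0 :> nat then 0 else l.+1 - i) :> nat.
Proof.
rewrite /pattern1rev; case: (unliftP ord0 i) => [j|] ->.
  by rewrite lift_perm_lift permE /= /bump /= !add1n subSS subnSK.
by rewrite lift_perm_id.
Qed.

(* Main.v *)
Require Import Defs.
From mathcomp Require Import all_boot all_fingroup.
From mathcomp Require Import zify.

(* The copies of [1 (l+1) l ... 2] in [p] are the pairs [(x, A)] where [A] is an
   antichain of size [l] above [x] in the poset of points of [p] ordered by "left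
   of and below".  Let [R] be the set of [m] maximal elements of a poset.
   Replacing all of [R] by [m] twins of one [r] in [R] and averaging over [r]
   does not decrease the number of copies, since ['C(u, j)] is convex in [u].
   Iterating, the maximum [M n] is reached by layered permutations, so
   [M n = max_i (M i + i * 'C(n - i, l))].  If the maximum is reached only at
   [i = k] and all other values are at most [M n - 2], the slack in the
   convexity inequality shows that a poset with [M n - 1] copies must have
   [n - k] maximal elements lying above all the [k] others; these [k] elements
   then carry [M k - 1] copies.  Hence if [M k - 1] is not attained in size [k],
   then [M n - 1] is not attained in size [n].  An [n] of this kind exists for
   every large [k], as the function [i |-> M i + i * 'C(n - i, l)] is concave for
   [i] up to about [n / l] and never beats its earlier values beyond.  The
   induction starts at [k <= l], where [M k = 0]. *)

Set Implicit Arguments.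
Unset Strict Implicit.
Unset Printing Implicit Defensive.

(** * The optimal counts *)

Lemma bin_pascal n k : 0 < k -> 'C(n.+1, k) = 'C(n, k) + 'C(n, k.-1).
Proof. by case: k. Qed.

Lemma leq_bin2r m n k : m <= n -> 'C(m, k) <= 'C(n, k).
Proof.
elim: k m n => [|k IH] m n; first by rewrite !bin0.
elim: n m => [|n IHn] m; first by rewrite leqn0 => /eqP ->.
rewrite leq_eqVlt => /orP[/eqP -> //|]; rewrite ltnS => le_mn.
by rewrite binS (leq_trans (IHn _ le_mn)) ?leq_addr.
Qed.

Lemma leq_bin_self m j : 0 < j < m -> m <= 'C(m, j).
Proof.
elim: m j => [|m IH] j; first by case: j.
case: j => // j /andP[_]; rewrite ltnS => lt_jm.
rewrite binS; case: j lt_jm => [|j] lt_jm; first by rewrite bin0 bin1 addn1.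
have [lt|] := ltnP j.+2 m.
  have := IH j.+2; have := bin_gt0 m j.+1; lia.
move=> ge; have -> : m = j.+2 by lia.
by rewrite binn binSn; lia.
Qed.

(** At an interior point the chord [u * 'C(m, j)] exceeds [m * 'C(u, j)] by at least ['C(m, j)].
    Absorbing twice, j(j-1)C(x,j) = x(x-1)C(x-2,j-2), leaves only [u <= m - 1] and monotonicity. *)
Lemma bin_strict_convex m u j : 0 < u < m -> 1 < j ->
  m * 'C(u, j) <= u.-1 * 'C(m, j).
Proof.
case: j => [|[|j]] //; case: u => // u /andP[_ lt_um] _.
case: m lt_um => // m lt_um; rewrite /=.
have key x : j.+2 * j.+1 * 'C(x.+1, j.+2) = x.+1 * x * 'C(x.-1, j).
  rewrite -mulnA (mulnCA j.+2) -mul_bin_diag mulnCA.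
  case: x => [|x]; first by rewrite bin0n !muln0.
  by rewrite -mul_bin_diag /= mulnA.
rewrite -(leq_pmul2l (m := j.+2 * j.+1)) // mulnCA key.
rewrite [leqRHS]mulnCA key.
have := @leq_bin2r u.-1 m.-1 j.
case: u lt_um => [|u] lt_um H; first by rewrite muln0 !mul0n muln0.
have {}H := H ltac:(lia).
have -> : m.+1 * (u.+2 * u.+1 * 'C(u.+1.-1, j)) = (u.+1 * m.+1) * (u.+2 * 'C(u.+1.-1, j)) by lia.
have -> : u.+1 * (m.+1 * m * 'C(m.-1, j)) = (u.+1 * m.+1) * (m * 'C(m.-1, j)) by lia.
by rewrite leq_mul2l leq_mul ?orbT.
Qed.

Lemma bin_convex m u j : u <= m -> m * 'C(u, j.+1) <= u * 'C(m, j.+1).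
Proof.
case: u => [|u]; first by rewrite bin0n muln0.
case: m => // m le_um.
rewrite -(leq_pmul2l (m := j.+1)) // mulnCA -mul_bin_diag.
rewrite [leqRHS]mulnCA -mul_bin_diag mulnCA leq_mul2l leq_mul2l.
by rewrite leq_bin2r ?orbT.
Qed.

Lemma leq_bin_add a b k : 0 < k -> 'C(a, k) + 'C(b, k) <= 'C(a + b, k).
Proof.
case: k => // k _; elim: b => [|b IH]; first by rewrite bin0n !addn0.
rewrite addnS !binS; have := @leq_bin2r b (a + b) k (leq_addl _ _); lia.
Qed.

Lemma leq_bin_double n k : 1 < k -> 4 * 'C(n, k) <= 'C(2 * n, k).
Proof.
case: k => [|[|k]] // _; case: n => [|n]; first by rewrite bin0n.
rewrite -(leq_pmul2l (m := k.+2)) // mulnCA -mul_bin_diag.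
rewrite -[X in X <= _]/(4 * (n.+1 * 'C(n, k.+1))) -mul_bin_diag.
have := @leq_bin_add n n k.+1 isT.
have := @leq_bin2r (n + n) (2 * n.+1).-1 k.+1 ltac:(lia).
move=> h1 h2; have := leq_mul (leqnn n.+1) (leq_trans h2 h1); lia.
Qed.

(* Jensen's inequality for the convex function [u |-> 'C(u, j)]. *)
Lemma bin_jensen m u j : u <= m ->
  m * 'C(u, j) <= u * 'C(m, j) + (m - u) * 'C(0, j).
Proof.
case: j => [|j] le_um; first by rewrite !bin0; lia.
by rewrite bin0n muln0 addn0 bin_convex.
Qed.

(** Turns the slack of [bin_strict_convex] into [m - 1], the amount that [cherries_stable] needs. *)
Lemma leq_pred_bin m j : 1 < j -> (j < m \/ j = 2 /\ 1 < m) -> m.-1 <= 'C(m, j).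
Proof.
move=> j_gt1 [lt_jm|[-> m_gt1]].
  by have := @leq_bin_self m j ltac:(lia); lia.
case: (ltnP 2 m) => [lt|ge]; first by have := @leq_bin_self m 2 ltac:(lia); lia.
by have -> : m = 2 by lia.
Qed.

(** * The recursion for the optimum and the position of the best split *)

Section OptimalCount.

Variable l : nat.
Hypothesis l_gt1 : 1 < l.

(** Fuel replaces course-of-values recursion: each call goes to a strictly smaller size, so [n]
    units suffice for size [n]. *)
Fixpoint max_count_fuel fuel n :=
  if fuel is fuel'.+1 then
    foldr (fun i => maxn (max_count_fuel fuel' i + i * 'C(n - i, l))) 0 (iota 0 n)
  else 0.

(* The largest number of copies in a layered permutation of size [n]; [i] is
   the number of entries below the last layer. *)
Definition max_count n := max_count_fuel n n.
Local Notation M := max_count.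

Definition split_count n i := M i + i * 'C(n - i, l).
Local Notation f := split_count.

Lemma max_count_fuelE fuel n : n <= fuel -> max_count_fuel fuel n = M n.
Proof.
elim: fuel {-2}fuel (leqnn fuel) n => [|b IH] fuel le_b n le_n.
  have -> : fuel = 0 by lia.
  by have -> : n = 0 by lia.
case: fuel le_b le_n => [|fuel] le_b le_n; first by have -> : n = 0 by lia.
case: n le_n => [|n] le_n; first by [].
rewrite /max_count [LHS]/= [RHS]/=.
have : all (fun i => i <= n) (0 :: iota 1 n).
  by apply/allP => i; rewrite -[_ :: _]/(iota 0 n.+1) mem_iota; lia.
rewrite -[maxn _ _]/(foldr (fun i => maxn (max_count_fuel fuel i + i * 'C(n.+1 - i, l))) 0 (0 :: iota 1 n)).
rewrite -[RHS]/(foldr (fun i => maxn (max_count_fuel n i + i * 'C(n.+1 - i, l))) 0 (0 :: iota 1 n)).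
elim: (0 :: iota 1 n) => //= i s IHs /andP[le_i /IHs ->].
by rewrite !IH //; lia.
Qed.

Lemma max_countE n :
  M n = foldr (fun i => maxn (f n i)) 0 (iota 0 n).
Proof.
case: n => // n; rewrite {1}/max_count /=.
rewrite -[LHS]/(foldr (fun i => maxn (max_count_fuel n i + i * 'C(n.+1 - i, l))) 0 (0 :: iota 1 n)).
rewrite -[RHS]/(foldr (fun i => maxn (f n.+1 i)) 0 (0 :: iota 1 n)).
have : all (fun i => i <= n) (0 :: iota 1 n).
  by apply/allP => i; rewrite -[_ :: _]/(iota 0 n.+1) mem_iota; lia.
elim: (0 :: iota 1 n) => //= i s IHs /andP[le_i /IHs ->].
by rewrite max_count_fuelE.
Qed.

Lemma split_count_le n i : i <= n -> f n i <= M n.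
Proof.
rewrite leq_eqVlt => /orP[/eqP ->|lt_in].
  by rewrite /split_count subnn bin0n (gtn_eqF (ltnW l_gt1)) muln0 addn0.
rewrite max_countE; have : i \in iota 0 n by rewrite mem_iota; lia.
elim: (iota 0 n) => //= j s IHs; rewrite inE leq_max.
by case/orP => [/eqP ->|/IHs ->]; rewrite ?leqnn ?orbT.
Qed.

Lemma max_count_split n : 0 < n ->
  exists j, [/\ j < n, M n = f n j & forall i, i < j -> f n i < M n].
Proof.
move=> n_gt0.
have ex : exists j, (j < n) && (M n == f n j).
  have : exists2 j, j \in iota 0 n & M n = f n j; last first.
    by case=> j; rewrite mem_iota => jn ->; exists j; rewrite eqxx; lia.
  rewrite max_countE; case: (iota 0 n) (size_iota 0 n) => [/= e|x s _]; first by lia.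
  elim: s x => [|y s IHs] x; first by exists x; rewrite ?inE //= maxn0.
  have [j js e] := IHs y.
  rewrite -[foldr _ _ _]/(maxn (f n x) (foldr (fun i => maxn (f n i)) 0 (y :: s))) e.
  case: (leqP (f n x) (f n j)) => h; last by exists x; rewrite ?inE ?eqxx.
  by exists j => //; rewrite inE js orbT.
case: (ex_minnP ex) => j /andP[lt_jn /eqP e] jmin; exists j; split=> // i lt_ij.
rewrite ltn_neqAle split_count_le ?andbT; last by lia.
apply/negP => /eqP e'; have := jmin i; rewrite e' eqxx; lia.
Qed.

Lemma max_count0 n : n <= l -> M n = 0.
Proof.
elim/ltn_ind: n => n IH le_nl; case: (posnP n) => [-> //|n_gt0].
have [j [lt_jn -> _]] := max_count_split n_gt0.
rewrite /split_count IH //; last by lia.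
case: j lt_jn => // j lt_jn; rewrite bin_small //; lia.
Qed.

Lemma leq_max_count m n : m <= n -> M m <= M n.
Proof.
by move=> le_mn; apply: leq_trans (split_count_le le_mn); apply: leq_addr.
Qed.

(** Removing a point of the last layer loses [j * 'C(n.-1 - j, l.-1)] copies, by Pascal's rule, and
    leaves a split of [n.-1]. *)
Lemma max_count_step n j : j < n -> M n = f n j ->
  M n <= M n.-1 + j * 'C(n.-1 - j, l.-1).
Proof.
move=> lt_jn ->; have := @split_count_le n.-1 j ltac:(lia).
rewrite /split_count; have -> : n - j = (n.-1 - j).+1 by lia.
rewrite bin_pascal ?mulnDr; lia.
Qed.

(** The last two layers have sizes [a - b] and [n - a]. If the lower one is not larger, one of its
    points moves to the last layer; otherwise the two layers are swapped, and [bin_strict_convex]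
    bounds the gain. *)
Lemma split_count_upper n a b : 0 < a < n -> n < a * l ->
    M a = f a b -> b < a -> b * l <= a ->
  f n a <= f n a.-1 /\ a - b <= n - a \/
  f n a + 'C(a - b, l) <= f n (b + (n - a)) /\ n - a < a - b.
Proof.
move=> a_n lt_nal Ma lt_ba le_bl.
case: (leqP (a - b) (n - a)) => le_vw; [left|right]; split=> //.
  have step := max_count_step lt_ba Ma.
  rewrite /split_count; set w := n - a in le_vw *.
  have -> : n - a.-1 = w.+1 by lia.
  rewrite bin_pascal; last by lia.
  have le1 : 'C(a.-1 - b, l.-1) <= 'C(w, l.-1) by apply: leq_bin2r; lia.
  suff : b * 'C(w, l.-1) + 'C(w, l) <= a.-1 * 'C(w, l.-1).
    have := leq_mul (leqnn b) le1.
    have -> : a * 'C(w, l) = a.-1 * 'C(w, l) + 'C(w, l) by nia.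
    rewrite mulnDr; lia.
  rewrite -(leq_pmul2l (m := l)); last by lia.
  have := mul_bin_left w l.-1; rewrite prednK => [H|]; last by lia.
  rewrite mulnDr H !mulnA -mulnDl leq_mul2r.
  case: (leqP l.-1 w) => h; last by rewrite bin_small.
  apply/orP; right.
  have -> : l * a.-1 = a * l - l by nia.
  have : w < a * l.-1 by rewrite /w; nia.
  have : a * l.-1 + a = a * l by nia.
  nia.
have := @split_count_le (b + (n - a)) b ltac:(lia).
rewrite /split_count Ma /split_count.
have -> : n - (b + (n - a)) = a - b by lia.
have -> : b + (n - a) - b = n - a by lia.
have w_pos : 0 < n - a < a - b by lia.
have := bin_strict_convex w_pos l_gt1.
set v := a - b; set w := n - a in w_pos *.
have -> : a = b + v by rewrite /v; lia.
rewrite !mulnDl.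
have : w * 'C(v, l) = w.-1 * 'C(v, l) + 'C(v, l) by nia.
lia.
Qed.

(** The least optimal split works: if [n < j * l], then [split_count_upper] yields a smaller index
    that is at least as good. *)
Lemma max_count_split_small n : 0 < n ->
  exists j, [/\ j < n, M n = f n j & j * l <= n].
Proof.
elim/ltn_ind: n => n IH n_gt0.
have [j [lt_jn Mn jmin]] := max_count_split n_gt0.
exists j; split=> //; rewrite leqNgt; apply/negP => lt_njl.
have j_gt0 : 0 < j by case: (j) lt_njl.
have [b [lt_bj Mj le_bl]] := IH j lt_jn j_gt0.
have j_n : 0 < j < n by rewrite j_gt0.
case: (split_count_upper j_n lt_njl Mj lt_bj le_bl) => [[h _]|[h hv]].
  by have := jmin j.-1; lia.
have := jmin (b + (n - j)); lia.
Qed.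

(** * Second differences and concavity *)

Lemma absorb_bin k : 0 < k ->
  'C(k * l.-1, l.-1) = k * 'C((k * l.-1).-1, l.-2).
Proof.
move=> k_gt0; apply/eqP; rewrite -(eqn_pmul2l (m := l.-1)); last by lia.
have := mul_bin_diag (k * l.-1) l.-2; rewrite prednK; last by lia.
move=> <-; apply/eqP; lia.
Qed.

(** Ratio test: with y = x - i - 1, (y+1)C(y,l-1) = (y+2-l)C(y+1,l-1), and the hypothesis gives
    i(y+1) <= (i+1)(y+2-l). *)
Lemma head_term_mono x i : i.+1 * l <= x.+1 ->
  i * 'C(x - i, l.-1) <= i.+1 * 'C(x - i.+1, l.-1).
Proof.
move=> le_ix; set y := x - i.+1.
have -> : x - i = y.+1 by rewrite /y; nia.
have := mul_bin_down y.+1 l.-1; rewrite /=.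
have : i * y.+1 <= i.+1 * (y.+1 - l.-1) by rewrite /y; nia.
move=> h e; rewrite -(leq_pmul2l (m := y.+1)) // .
have := leq_mul h (leqnn 'C(y.+1, l.-1)).
move: e; nia.
Qed.

Lemma head_term_homo x i j : i <= j -> j * l <= x.+1 ->
  i * 'C(x - i, l.-1) <= j * 'C(x - j, l.-1).
Proof.
elim: j => [|j IH]; first by case: i.
rewrite leq_eqVlt => /orP[/eqP -> //|]; rewrite ltnS => le_ij le_jx.
by apply: leq_trans (IH le_ij _) (head_term_mono le_jx); nia.
Qed.

(* The second difference of the optimal counts, by induction on [k].  When the
   optimal lower parts [j] of [k.+1] and [j'] of [k.-1] satisfy [j <= j'],
   both are compared with lower parts of the same sizes at [k]; otherwise with
   lower parts of sizes [j.-1] and [j'.+1], so that the upper layers keep their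
   sizes and the smaller second differences take over. *)
Lemma max_count_second_diff k : 0 < k ->
  M k.+1 + M k.-1 <= 2 * M k + k.-1 * 'C((k * l.-1).-1, l.-2).
Proof.
elim/ltn_ind: k => k IH k_gt0.
case: (ltnP 1 k) => [k_gt1|k_le1]; last first.
  have -> : k = 1 by lia.
  by rewrite !max_count0 //; lia.
have [j [lt_jk Mj le_jl]] := @max_count_split_small k.+1 isT.
have [j' [lt_jk' Mj' le_jl']] := @max_count_split_small k.-1 ltac:(lia).
case: (leqP j j') => [le_jj|lt_jj].
  have h1 := max_count_step lt_jk Mj; rewrite /= in h1.
  have := @split_count_le k j' ltac:(lia).
  rewrite /split_count; have -> : k - j' = (k.-1 - j').+1 by lia.
  rewrite bin_pascal ?mulnDr; last by lia.
  have := Mj'; rewrite /split_count => -> => h2.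
  have h3 := @head_term_homo k.-1 j j' le_jj ltac:(lia).
  have h4 : j * 'C(k - j, l.-1) = j * 'C(k.-1 - j, l.-1) + j * 'C(k.-1 - j, l.-2).
    have -> : k - j = (k.-1 - j).+1 by nia.
    rewrite bin_pascal ?mulnDr //; lia.
  have h5 : j * 'C(k.-1 - j, l.-2) <= k.-1 * 'C((k * l.-1).-1, l.-2).
    apply: leq_mul; first by lia.
    apply: leq_bin2r; nia.
  lia.
(* The quantity [M i.+1 - M i + 'C(k - i, l)] does not increase on this range: the second difference
   of [M] at [i.+1] is at most ['C(k - i.+1, l.-1)], the drop of the binomial. *)
have le_tail i : j' <= i < j ->
    M i.+1 + 'C(k - i, l) + M j' <= M i + 'C(k - j', l) + M j'.+1.
  elim: i => [|i IHi] i_j; first by have -> : j' = 0; lia.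
  case: (ltnP i j') => [lt_ij|le_ji]; first by have -> : j' = i.+1; lia.
  have {}IHi := IHi ltac:(lia).
  have s := IH i.+1 ltac:(nia) isT; rewrite [i.+1.-1]/= in s.
  have h1 : i * 'C((i.+1 * l.-1).-1, l.-2) <= 'C(k - i.+1, l.-1).
    apply: (@leq_trans 'C(i.+1 * l.-1, l.-1)); last by apply: leq_bin2r; nia.
    by rewrite absorb_bin // leq_mul.
  have : 'C(k - i, l) = 'C(k - i.+1, l) + 'C(k - i.+1, l.-1).
    have -> : k - i = (k - i.+1).+1 by nia.
    rewrite bin_pascal //; lia.
  lia.
have h1 := le_tail j.-1 ltac:(lia); rewrite prednK in h1; last by lia.
have := @split_count_le k j.-1 ltac:(nia).
have := @split_count_le k j'.+1 ltac:(lia).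
move: Mj Mj'; rewrite /split_count.
have -> : k - j.-1 = k.+1 - j by nia.
have -> : k.-1 - j' = k - j'.+1 by lia.
have h2 : 'C(k - j', l) = 'C(k - j'.+1, l) + 'C(k - j'.+1, l.-1).
  have -> : k - j' = (k - j'.+1).+1 by lia.
  rewrite bin_pascal //; lia.
have h3 : 'C(k - j'.+1, l.-1) <= k.-1 * 'C((k * l.-1).-1, l.-2).
  apply: leq_trans (@leq_bin2r _ k.-1 _ _) _; first by lia.
  rewrite -(leq_pmul2l (m := l.-1)); last by lia.
  have := mul_bin_diag k.-1 l.-2; rewrite prednK; last by lia.
  move=> <-; rewrite mulnCA leq_mul2l; apply/orP; right.
  apply: leq_trans (leq_pmull _ _); last by lia.
  apply: leq_bin2r; nia.
have -> : j * 'C(k.+1 - j, l) = j.-1 * 'C(k.+1 - j, l) + 'C(k.+1 - j, l).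
  by rewrite -{1}(prednK (n := j)) ?mulSn; lia.
have : 'C(k - j.-1, l) = 'C(k.+1 - j, l) by congr 'C(_, l); nia.
rewrite mulSn => e; move: h1; rewrite e; lia.
Qed.

Lemma max_count_second_diff_bin k : 0 < k ->
  M k.+1 + M k.-1 <= 2 * M k + 'C(k * l.-1, l.-1).
Proof.
move=> k_gt0; apply: leq_trans (max_count_second_diff k_gt0) _.
by rewrite leq_add2l absorb_bin // leq_mul2r leq_pred orbT.
Qed.

(** With x = n - e - 1, the term e C(n-e,l) has second difference (e-1)C(x,l-2) - 2C(x,l-1). Both
    (e-1)C(x,l-2) and the second difference of [M] are at most C(x,l-1), since x >= e(l-1). *)
Lemma split_count_concave n e : 0 < e -> e * l < n ->
  f n e.+1 + f n e.-1 <= 2 * f n e.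
Proof.
move=> e_gt0 lt_eln; rewrite /split_count.
set x := n - e.+1.
have le_ex : e * l.-1 <= x by rewrite /x; nia.
have -> : n - e = x.+1 by rewrite /x; nia.
have -> : n - e.-1 = x.+2 by rewrite /x; nia.
have l_pos : 0 < l by lia.
have l1_pos : 0 < l.-1 by lia.
rewrite !(bin_pascal _ l_pos) (bin_pascal _ l1_pos).
have s := max_count_second_diff_bin e_gt0.
have h1 : 'C(e * l.-1, l.-1) <= 'C(x, l.-1) by apply: leq_bin2r.
have h2 : e.-1 * 'C(x, l.-2) <= 'C(x, l.-1).
  rewrite -(leq_pmul2l (m := l.-1)) //.
  have := mul_bin_left x l.-2; rewrite prednK // => ->.
  rewrite mulnA leq_mul2r; apply/orP; right; nia.
clearbody x; case: e e_gt0 {lt_eln le_ex} s h1 h2 => // e _.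
rewrite [e.+1.-1]/= => s h1 h2.
rewrite !(mulSn e) !mulnDr; lia.
Qed.

(** The boundary case for [split_margin]: at the last size before its search range, [k] gains at
    most 1 over [k.-1]. *)
Lemma split_count_start k : l <= k -> (l = 2 -> 6 <= k) ->
  f (k * l + 2) k <= f (k * l + 2) k.-1 + 1.
Proof.
move=> le_lk l2; have k_gt0 : 0 < k by lia.
have [b [lt_bk Mk le_bl]] := max_count_split_small k_gt0.
have step := max_count_step lt_bk Mk.
rewrite /split_count; set w := k * l.-1 + 2.
have -> : k * l + 2 - k.-1 = w.+1 by rewrite /w; nia.
have -> : k * l + 2 - k = w by rewrite /w; nia.
rewrite bin_pascal; last by lia.
suff h : b * 'C(k.-1 - b, l.-1) + 'C(w, l) <= k.-1 * 'C(w, l.-1) + 1.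
  rewrite mulnDr; have -> : k * 'C(w, l) = k.-1 * 'C(w, l) + 'C(w, l) by nia.
  lia.
rewrite -(leq_pmul2l (m := l)); last by lia.
have := mul_bin_left w l.-1; rewrite prednK => [e|]; last by lia.
rewrite !mulnDr e.
suff h : l * b * 'C(k.-1 - b, l.-1) <= (k - 3) * 'C(w, l.-1) + l.
  have e1 : l * k.-1 = (w - l.-1) + (k - 3) by rewrite /w; nia.
  rewrite !mulnA e1 mulnDl; lia.
case: (ltnP 2 l) => [l_gt2|l_le2]; last first.
  have l_eq2 : l = 2 by lia.
  rewrite /w l_eq2 !bin1; have := l2 l_eq2.
  (* For [l = 2] the binomials are linear, and AM-GM bounds [b * (k.-1 - b)]. *)
  have := nat_AGM2 b (k.-1 - b); rewrite subnKC; last by lia.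
  set bc := b * _; rewrite -mulnA -/bc -mulnn => AGM /subnKC def_k.
  move: AGM; rewrite -def_k; nia.
case: (posnP b) => [->|b_gt0]; first by rewrite muln0.
(* Past this case [k >= l + b >= 4], which gives [k <= 4 * (k - 3)] in [h4]. *)
case: (ltnP (k.-1 - b) l.-1) => [lt|ge]; first by rewrite (bin_small lt) muln0.
have h1 : 'C(k.-1 - b, l.-1) <= 'C(k - 2, l.-1) by apply: leq_bin2r; lia.
have h2 : 4 * 'C(k - 2, l.-1) <= 'C(w, l.-1).
  by apply: leq_trans (leq_bin_double _ _) (leq_bin2r _ _); rewrite ?/w; nia.
have h3 : l * b * 'C(k.-1 - b, l.-1) <= k * 'C(k - 2, l.-1).
  by apply: leq_mul; lia.
have h4 : k * 'C(k - 2, l.-1) <= (k - 3) * (4 * 'C(k - 2, l.-1)).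
  by rewrite mulnA leq_mul2r; apply/orP; right; lia.
have := leq_mul (leqnn (k - 3)) h2; lia.
Qed.

(* [n] is the first size, past the range where the gain of [k] over [k.-1]
   need not increase, at which that gain is at least [2]. *)
Lemma split_margin k : l <= k -> (l = 2 -> 6 <= k) ->
  exists n, k + l < n /\ forall i, i < n -> i != k -> f n i + 2 <= f n k.
Proof.
move=> le_lk l2.
pose P w := (k * l.-1 + 2 < w) && (f (k + w) k.-1 + 2 <= f (k + w) k).
have k_gt0 : 0 < k by lia.
have exP : exists w, P w.
  (* Large enough because [l * 'C(w, l) = (w - l.-1) * 'C(w, l.-1)] and [w - l.-1] exceeds
     [l * k.-1] by [l + 1]. *)
  exists (l * k + l); rewrite /P; apply/andP; split; first by nia.
  rewrite /split_count; set w := l * k + l.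
  have -> : k + w - k.-1 = w.+1 by lia.
  have -> : k + w - k = w by lia.
  have := leq_max_count (leq_pred k).
  rewrite bin_pascal; last by lia.
  suff : k.-1 * 'C(w, l.-1) + 2 <= 'C(w, l).
    rewrite mulnDr; have -> : k * 'C(w, l) = k.-1 * 'C(w, l) + 'C(w, l) by nia.
    lia.
  rewrite -(leq_pmul2l (m := l)); last by lia.
  have := mul_bin_left w l.-1; rewrite prednK => [->|]; last by lia.
  have : w <= 'C(w, l.-1) by apply: leq_bin_self; rewrite /w; nia.
  have -> : w - l.-1 = l * k.-1 + l + 1 by rewrite /w; nia.
  set c := 'C(w, l.-1) => le_wc; rewrite mulnDr !mulnA !mulnDl.
  have : l * w <= l * c by rewrite leq_mul2l le_wc orbT.
  rewrite /w; nia.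
case: (ex_minnP exP) => w /andP[w_big gain] wmin.
have w_gt2 : 2 < w by apply: leq_trans w_big; rewrite ltnS leq_addl.
set n := k + w in gain.
(* By minimality of [w], or by [split_count_start] when [w.-1] is just below the search range. *)
have nogain : f n.-1 k <= f n.-1 k.-1 + 1.
  case: (ltnP (k * l.-1 + 2) w.-1) => [big|small].
    have : ~~ P w.-1 by apply/negP => /wmin; lia.
    rewrite /P big /=; have -> : k + w.-1 = n.-1 by rewrite /n; lia.
    lia.
  have -> : n.-1 = k * l + 2 by rewrite /n; nia.
  exact: split_count_start.
have next : f n k.+1 + 2 <= f n k.
  (* The 3 is the margin 2 plus the 1 allowed in [nogain]. For [l = 2] it fits only thanks to the
     factor [k.-1], instead of [k], in [max_count_second_diff]. *)
  have : M k.+1 + M k.-1 + 3 <= 2 * M k + 'C(w.-1, l.-1).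
    have := max_count_second_diff k_gt0.
    suff : k.-1 * 'C((k * l.-1).-1, l.-2) + 3 <= 'C(w.-1, l.-1) by lia.
    case: (ltnP 2 l) => [l_gt2|l_le2]; last first.
      have l_eq2 : l = 2 by lia.
      by move: w_big; rewrite l_eq2 bin0 bin1; lia.
    apply: (@leq_trans 'C(k * l.-1, l.-1)); last by apply: leq_bin2r; lia.
    rewrite absorb_bin //; have := @leq_bin_self (k * l.-1).-1 l.-2 ltac:(nia).
    have : 3 <= (k * l.-1).-1 by nia.
    nia.
  move: nogain; rewrite /split_count.
  have -> : n.-1 - k = w.-1 by rewrite /n; lia.
  have -> : n.-1 - k.-1 = w by rewrite /n; lia.
  have -> : n - k.+1 = w.-1 by rewrite /n; lia.
  have -> : n - k = w by rewrite /n; lia.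
  have -> : 'C(w, l) = 'C(w.-1, l) + 'C(w.-1, l.-1).
    have w_gt0 : 0 < w by lia.
    by rewrite -{1}(prednK w_gt0) bin_pascal //; lia.
  rewrite !mulnDr !mulSn.
  have : k * 'C(w.-1, l.-1) = k.-1 * 'C(w.-1, l.-1) + 'C(w.-1, l.-1) by nia.
  have : k * 'C(w.-1, l) = k.-1 * 'C(w.-1, l) + 'C(w.-1, l) by nia.
  lia.
(* Below [k], concavity propagates the gain of 2 downwards. *)
have below d : d < k -> f n (k - d.+1) + 2 <= f n (k - d).
  elim: d => [|d IHd] lt_dk; first by rewrite subn0 subn1.
  have := @split_count_concave n (k - d.+1) ltac:(lia) ltac:(rewrite /n; nia).
  have -> : (k - d.+1).-1 = k - d.+2 by lia.
  have -> : (k - d.+1).+1 = k - d by lia.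
  have := IHd ltac:(lia); lia.
have below_k i : i < k -> f n i + 2 <= f n k.
  move=> lt_ik; have -> : i = k - (k - i.+1).+1 by lia.
  have : k - i.+1 < k by lia.
  elim: (k - i.+1) => [|d IHd] lt_dk; first by have := below 0; rewrite subn0; lia.
  have := below d.+1; have := IHd; lia.
exists n; split; first by rewrite /n; nia.
move=> i lt_in neq_ik; case: (ltngtP i k) neq_ik => // [/below_k //|lt_ki] _.
elim/ltn_ind: i lt_in lt_ki => a IH lt_an lt_ka.
(* Above [k], concavity propagates the loss given by [next] up to about [n / l]; beyond,
   [split_count_upper] leads back to a smaller index that is still at least [k], or to one below
   [k]. *)
case: (ltnP (a.-1 * l) n) => [concave|convex].
  suff : f n a + 2 <= f n a.-1.
    case: (ltnP k a.-1) => [lt|ge]; first by have := IH a.-1; lia.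
    have -> : a.-1 = k by lia.
    by [].
  have {IH}: k < a by [].
  elim: a {lt_ka} concave lt_an => // a IHa concave lt_an.
  rewrite ltnS leq_eqVlt => /orP[/eqP <- //|lt_ka].
  have := IHa ltac:(nia) ltac:(lia) lt_ka.
  have := @split_count_concave n a ltac:(lia) concave.
  rewrite /=; lia.
have a_gt0 : 0 < a by lia.
have [b [lt_ba Ma le_bl]] := max_count_split_small a_gt0.
have a_n : 0 < a < n by lia.
have lt_nal : n < a * l by nia.
case: (split_count_upper a_n lt_nal Ma lt_ba le_bl) => -[le_f cmp].
  have := IH a.-1 ltac:(lia) ltac:(lia).
  case: (ltnP k a.-1) => [lt /(_ isT)|ge _]; first by lia.
  have e : a.-1 = k by lia.
  move: convex; rewrite e /n; nia.
have v_big : l < a - b.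
  have : n < 2 * a by lia.
  rewrite /n; nia.
(* The swap may land exactly on [k], so its own gain has to supply the margin. *)
have : 2 <= 'C(a - b, l) by have := @leq_bin_self (a - b) l ltac:(lia); lia.
have ltb : b + (n - a) < a by lia.
move: le_f; set c := b + (n - a) in ltb *.
case: (ltngtP c k) => [/below_k|lt|->]; try lia.
have := IH c ltb (ltn_trans ltb lt_an) lt; lia.
Qed.

End OptimalCount.

(** * Cherries in posets *)

Section PosetCount.

Variables (T : finType) (l : nat).
Hypothesis l_gt1 : 1 < l.
Implicit Types (lt : rel T) (E R A B : {set T}) (x y r : T).

Definition antichain lt A := [forall a in A, forall b in A, ~~ lt a b].

Definition above lt x A := [forall a in A, lt x a].

(* With [lt] the relation "to the left of and below", the pairs [(x, A)] with
   [cherry lt E x A] are the copies of the pattern inside [E]: [x] plays the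
   entry [1] and [A] the decreasing part. *)
Definition cherry lt E x A :=
  [&& A \subset E, #|A| == l, antichain lt A & above lt x A].

Definition cherries lt E := \sum_(x in E) #|[set A | cherry lt E x A]|.

Definition top lt E := [set x in E | [forall y in E, ~~ lt x y]].

(* The points of [R] that may be added to [B] to form a cherry with root [x]. *)
Definition link lt R x B :=
  [set r in R | lt x r && [forall b in B, ~~ lt b r]].

(** What remains of the antichain of a cherry once the maximal points are removed; the other
    [l - #|B|] points come from [link]. *)
Definition stem lt E x B :=
  [&& B \subset E, #|B| <= l, antichain lt B & above lt x B].

Lemma antichainP lt A :
  reflect {in A &, forall a b, ~~ lt a b} (antichain lt A).
Proof.
apply: (iffP forall_inP) => [h a b aA bA|h a aA].
  by have /forall_inP := h a aA; apply.
by apply/forall_inP => b bA; apply: h.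
Qed.

Lemma aboveP lt x A : reflect {in A, forall a, lt x a} (above lt x A).
Proof. exact: forall_inP. Qed.

Lemma topP lt E x :
  reflect (x \in E /\ {in E, forall y, ~~ lt x y}) (x \in top lt E).
Proof.
rewrite inE; apply: (iffP andP) => -[xE h]; split=> //; exact/forall_inP.
Qed.

Lemma link_sub lt R x B : link lt R x B \subset R.
Proof. by apply/subsetP => r; rewrite inE => /andP[]. Qed.

(** Points of [R] are maximal, so any [l - #|B|] points of the link complete [B] to an antichain
    above [x]. *)
Lemma card_fiber_cherry lt E R x B : R \subset E ->
    {in R & E, forall r y, ~~ lt r y} -> stem lt (E :\: R) x B ->
  #|[set A | cherry lt E x A && (A :\: R == B)]| = 'C(#|link lt R x B|, l - #|B|).
Proof.
move=> sRE maxR /and4P[sBE cardB /antichainP antiB /aboveP aboveB].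
rewrite -cards_draws.
have disj A : A \subset R -> B :&: A = set0.
  move=> sAR; apply/setP => b; rewrite !inE; apply/negP => /andP[/(subsetP sBE)].
  by rewrite inE => /andP[nR _] /(subsetP sAR); rewrite (negPf nR).
have sLR := link_sub lt R x B.
pose S := [set A : {set T} | A \subset link lt R x B & #|A| == l - #|B|].
rewrite -[RHS]/(#|S|) -(card_in_imset (f := fun A => B :|: A) (D := mem S)).
  apply: eq_card => A; rewrite !inE; apply/idP/imsetP.
    case/andP => /and4P[sAE /eqP cardA /antichainP antiA /aboveP aboveA] /eqP defB.
    have eA : A = B :|: A :&: R by rewrite -defB setUC setID.
    exists (A :&: R) => //; rewrite inE; apply/andP; split.
      apply/subsetP => r /setIP[rA rR]; rewrite inE rR aboveA //=.
      apply/forall_inP => b bB; apply: antiA => //.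
      by rewrite eA inE bB.
    have := cardsID R A; rewrite defB cardA => <-; rewrite addnK //.
  case=> A0; rewrite inE => /andP[sA0 /eqP cardA0] ->.
  have sA0R := subset_trans sA0 sLR.
  have A0P a : a \in A0 -> [/\ a \in R, lt x a & {in B, forall b, ~~ lt b a}].
    move=> /(subsetP sA0); rewrite inE => /and3P[-> -> /forall_inP h].
    by split.
  apply/andP; split; last first.
    apply/eqP/setP => b; rewrite !inE; apply/andP/idP.
      by case=> nR /orP[//|/(subsetP sA0R)]; rewrite (negPf nR).
    by move=> bB; have := subsetP sBE b bB; rewrite inE => /andP[-> _]; rewrite bB.
  apply/and4P; split.
  - rewrite subUset (subset_trans sBE) ?subsetDl //.
    exact: subset_trans sRE.
  - by rewrite cardsU disj // cards0 subn0 cardA0 subnKC.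
  - apply/antichainP => a b; rewrite !inE => /orP[aB|/A0P[aR xa hB]] /orP[bB|bA].
    + exact: antiB.
    + by have [_ _ ->] := A0P _ bA.
    + by apply: maxR => //; have := subsetP sBE b bB; rewrite inE => /andP[].
    + by apply: maxR => //; have [bR _ _] := A0P _ bA; apply: (subsetP sRE).
  - by apply/aboveP => a; rewrite inE => /orP[/aboveB|/A0P[]].
move=> A1 A2; rewrite !inE => /andP[s1 _] /andP[s2 _] e.
have {}s1 := subset_trans s1 sLR; have {}s2 := subset_trans s2 sLR.
apply/setP => a; have := congr1 (fun A => a \in A :&: R) e.
rewrite !inE.
case aB: (a \in B) => /=.
  have := subsetP sBE a aB; rewrite inE => /andP[nR _] _.
  have n A : A \subset R -> (a \in A) = false.
    by move=> sA; apply/negbTE; apply: contra nR => /(subsetP sA).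
  by rewrite !n.
case aR: (a \in R); rewrite ?andbT // => _.
have n A : A \subset R -> (a \in A) = false.
  by move=> sA; apply/negbTE; move/negbT: aR; apply: contra => /(subsetP sA).
by rewrite !n.
Qed.

Lemma cherries_stem lt E R : R \subset E ->
    {in R & E, forall r y, ~~ lt r y} ->
  cherries lt E = \sum_(x in E :\: R) \sum_(B | stem lt (E :\: R) x B)
    'C(#|link lt R x B|, l - #|B|).
Proof.
move=> sRE maxR; rewrite /cherries (big_setID R) /= big1 ?add0n.
  apply: eq_bigr => x _; rewrite -sum1_card.
  rewrite (partition_big (fun A => A :\: R) (stem lt (E :\: R) x)) /=.
    apply: eq_bigr => B stB; rewrite -(card_fiber_cherry sRE maxR stB) -sum1_card.
    by apply: eq_bigl => A; rewrite !inE.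
  move=> A; rewrite inE => /and4P[sA /eqP cA /antichainP antiA /aboveP aboveA].
  apply/and4P; split; first exact: setSD.
  - by rewrite -cA subset_leq_card ?subsetDl.
  - by apply/antichainP => a b /setDP[aA _] /setDP[bA _]; apply: antiA.
  - by apply/aboveP => a /setDP[aA _]; apply: aboveA.
move=> x /setIP[xE xR]; apply/eqP; rewrite cards_eq0; apply/eqP/setP => A.
rewrite !inE; apply/negP => /and4P[sA /eqP cA _ /aboveP aboveA].
have : 0 < #|A| by rewrite cA; lia.
case/card_gt0P => a aA; have := aboveA _ aA.
by rewrite (negPf (maxR _ _ xR (subsetP sA _ aA))).
Qed.

Lemma stem0 lt E x : stem lt E x set0.
Proof.
rewrite /stem sub0set cards0 /=; apply/andP; split.
  by apply/antichainP => a; rewrite inE.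
by apply/aboveP => a; rewrite inE.
Qed.

(** An antichain cannot meet both [R] and its complement here: a nonempty [B] has an empty link.
    Cherries thus lie in [E :\: R], or have their antichain inside [R]. *)
Lemma cherries_complete lt E R : R \subset E ->
    {in R & E, forall r y, ~~ lt r y} -> {in E :\: R & R, forall x r, lt x r} ->
  cherries lt E = cherries lt (E :\: R) + #|E :\: R| * 'C(#|R|, l).
Proof.
move=> sRE maxR compl; rewrite (cherries_stem sRE maxR) /cherries.
rewrite -sum_nat_const -big_split /=; apply: eq_bigr => x xE.
rewrite (bigD1 set0) ?stem0 //=.
rewrite addnC cards0 subn0; congr (_ + 'C(_, _)); last first.
  apply: eq_card => r; rewrite !inE; case rR: (r \in R) => //=.
  by rewrite compl //=; apply/forall_inP => b; rewrite inE.
rewrite -sum1_card [RHS]big_mkcond [LHS]big_mkcond /=; apply: eq_bigr => B _.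
rewrite inE /stem /cherry; case: (B \subset _) / idP => //= sB.
case: (set_0Vmem B) => [->|[b bB]].
  by rewrite eqxx andbF cards0 (ltn_eqF (ltnW l_gt1)).
have -> : B != set0 by apply/set0Pn; exists b.
rewrite andbT.
have -> : link lt R x B = set0.
  apply/setP => r; rewrite !inE; apply/negP => /and3P[rR _ /forall_inP h].
  by have := h b bB; rewrite compl // (subsetP sB).
rewrite cards0 bin0n.
by case: (antichain lt B); case: (above lt x B); rewrite ?andbF ?andbT //= subn_eq0; case: ltngtP.
Qed.

(** * Turning all maximal elements into twins *)

Definition merge R r x := if x \in R then r else x.

(** As a pullback of [lt], the new relation inherits transitivity and irreflexivity; points of [R]
    become incomparable copies of [r]. *)
Definition merged lt R r : rel T := fun x y => lt (merge R r x) (merge R r y).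

Lemma merged_trans lt R r : transitive lt -> transitive (merged lt R r).
Proof. by move=> tr y x z; apply: tr. Qed.

Lemma merged_irr lt R r : irreflexive lt -> irreflexive (merged lt R r).
Proof. by move=> irr x; apply: irr. Qed.

Lemma merged_max lt E r : r \in top lt E ->
  {in top lt E & E, forall s y, ~~ merged lt (top lt E) r s y}.
Proof.
move=> rtop s y stop yE; rewrite /merged /merge stop.
have [rE rmax] := topP _ _ _ rtop.
by case: ifP => _; apply: rmax.
Qed.

Lemma top_sub lt E : top lt E \subset E.
Proof. by apply/subsetP => x /topP[]. Qed.

Lemma top_max lt E : {in top lt E & E, forall r y, ~~ lt r y}.
Proof. by move=> r y /topP[_ h]; apply: h. Qed.

Lemma stem_merged lt E r x B : x \in E :\: top lt E ->
  stem (merged lt (top lt E) r) (E :\: top lt E) x B = stem lt (E :\: top lt E) x B.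
Proof.
rewrite inE => /andP[nx xE].
rewrite /stem; case sB: (B \subset _) => //=; case: (_ <= l) => //=.
have nB b : b \in B -> b \in top lt E = false.
  by move=> /(subsetP sB); rewrite inE => /andP[/negbTE].
congr andb.
  apply/antichainP/antichainP => h a b aB bB; have := h a b aB bB;
  by rewrite /merged /merge !nB.
by apply/aboveP/aboveP => h a aB; have := h a aB;
  rewrite /merged /merge (negPf nx) nB.
Qed.

Lemma link_merged lt E r x B : x \in E :\: top lt E ->
    B \subset E :\: top lt E -> r \in top lt E ->
  link (merged lt (top lt E) r) (top lt E) x B =
    if r \in link lt (top lt E) x B then top lt E else set0.
Proof.
move=> xE sB rtop; have [nx _] := setDP xE.
have nB b : b \in B -> b \in top lt E = false.
  by move=> /(subsetP sB); rewrite inE => /andP[/negbTE].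
have xntop : x \in top lt E = false by move: xE; rewrite inE => /andP[/negbTE].
apply/setP => s; rewrite inE.
case stop: (s \in top lt E) => /=; last by case: ifP; rewrite ?stop ?in_set0.
have -> : merged lt (top lt E) r x s = lt x r.
  by rewrite /merged /merge stop xntop.
have -> : [forall b in B, ~~ merged lt (top lt E) r b s] = [forall b in B, ~~ lt b r].
  apply: eq_forallb => b; case bB: (b \in B) => //=.
  by rewrite /merged /merge stop nB.
by rewrite [r \in link _ _ _ _]inE rtop /=; case: ifP; rewrite ?stop ?in_set0.
Qed.

(** After merging at [r], the link of a stem is all of [R] if it contained [r], and empty otherwise.
    Summing over [r] produces the chord in [bin_jensen]. *)
Lemma sum_cherries_merged lt E (R := top lt E) :
  \sum_(r in R) cherries (merged lt R r) E =
  \sum_(x in E :\: R) \sum_(B | stem lt (E :\: R) x B)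
    (#|link lt R x B| * 'C(#|R|, l - #|B|) +
     (#|R| - #|link lt R x B|) * 'C(0, l - #|B|)).
Proof.
transitivity (\sum_(r in R) \sum_(x in E :\: R) \sum_(B | stem lt (E :\: R) x B)
    'C(#|if r \in link lt R x B then R else set0|, l - #|B|)).
  apply: eq_bigr => r rR; rewrite (@cherries_stem _ _ R) ?top_sub //; last first.
    exact: merged_max.
  apply: eq_bigr => x xE; apply: eq_big => [B|B]; rewrite stem_merged //.
  by case/and4P => sB _ _ _; rewrite link_merged.
rewrite exchange_big; apply: eq_bigr => x xE; rewrite exchange_big.
apply: eq_bigr => B _ /=.
have sL := link_sub lt R x B.
rewrite (big_setID (link lt R x B)) /= (setIidPr sL).
have cardD : #|R :\: link lt R x B| = #|R| - #|link lt R x B|.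
  by rewrite cardsD (setIidPr sL).
rewrite -cardD -!sum_nat_const; congr addn; apply: eq_bigr => r.
  by move=> ->.
by rewrite inE => /andP[/negbTE -> _]; rewrite cards0.
Qed.

Lemma cherries_merge_le lt E (R := top lt E) :
  #|R| * cherries lt E <= \sum_(r in R) cherries (merged lt R r) E.
Proof.
rewrite sum_cherries_merged (cherries_stem (top_sub lt E) (@top_max lt E)) big_distrr.
apply: leq_sum => x _; rewrite big_distrr; apply: leq_sum => B _.
by apply: bin_jensen; rewrite subset_leq_card ?link_sub.
Qed.

Lemma cherries_merge_gain lt E x B (R := top lt E) :
    x \in E :\: R -> stem lt (E :\: R) x B ->
    0 < #|link lt R x B| < #|R| -> #|B| + 1 < l ->
  #|R| * cherries lt E + 'C(#|R|, l - #|B|) <=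
    \sum_(r in R) cherries (merged lt R r) E.
Proof.
move=> xE stB partial ltBl.
rewrite sum_cherries_merged (cherries_stem (top_sub lt E) (@top_max lt E)) big_distrr.
rewrite [\sum_(x in E :\: R) _](bigD1 x) //= -/R.
rewrite [\sum_(y in _ :\: _) \sum_(C | _) (_ + _)](bigD1 x) //= -/R.
rewrite addnAC; apply: leq_add; last first.
  apply: leq_sum => y _; rewrite big_distrr; apply: leq_sum => C _.
  by apply: bin_jensen; rewrite subset_leq_card ?link_sub.
rewrite big_distrr [X in X + _ <= _](bigD1 B) //= [X in _ <= X](bigD1 B) //=.
rewrite addnAC; apply: leq_add; last first.
  apply: leq_sum => C _.
  by apply: bin_jensen; rewrite subset_leq_card ?link_sub.
have := @bin_strict_convex #|R| #|link lt R x B| (l - #|B|) partial ltac:(lia).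
rewrite bin0n subn_eq0; have -> : (l <= #|B|) = false by lia.
rewrite muln0 addn0.
move: partial; case: #|link lt R x B| => // u _.
by rewrite mulSn addnC => ?; rewrite leq_add2l.
Qed.

Lemma exists_top lt E x : transitive lt -> irreflexive lt -> x \in E ->
  x \notin top lt E -> exists2 r, r \in top lt E & lt x r.
Proof.
move=> tr irr xE nx.
have [y yE lt_xy] : exists2 y, y \in E & lt x y.
  move: nx; rewrite inE xE /= negb_forall_in => /exists_inP[y yE].
  by rewrite negbK; exists y.
pose P := [pred y | (y \in E) && lt x y].
have Py : P y by rewrite /= yE.
(* A point above [x] with the fewest points of [E] above it is maximal. *)
case: (@arg_minnP _ y P (fun z => #|[set w in E | lt z w]|) Py) => r /andP[rE lt_xr] rmin.
exists r => //; apply/topP; split=> // w wE; apply/negP => lt_rw.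
have := rmin w; rewrite /= wE (tr _ _ _ lt_xr lt_rw) => /(_ isT); apply/negP.
rewrite -ltnNge; apply: proper_card; apply/properP; split.
  by apply/subsetP => z; rewrite !inE => /andP[-> lt_wz]; rewrite (tr _ _ _ lt_rw).
by exists w; rewrite !inE wE ?irr.
Qed.

Definition complete lt E :=
  [forall x in E :\: top lt E, forall r in top lt E, lt x r].

Lemma completeP lt E :
  reflect {in E :\: top lt E & top lt E, forall x r, lt x r} (complete lt E).
Proof.
apply: (iffP forall_inP) => [h a b aA bA|h a aA].
  by have /forall_inP := h a aA; apply.
by apply/forall_inP => b bB; apply: h.
Qed.

Definition off lt E r := [set z in E :\: top lt E | ~~ lt z r].

Lemma top_merged lt E r : r \in top lt E ->
  top lt E \subset top (merged lt (top lt E) r) E.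
Proof.
move=> rtop; apply/subsetP => s stop; apply/topP; split.
  by have := subsetP (top_sub lt E) s stop.
by move=> y yE; apply: merged_max.
Qed.

Lemma top_merged_off0 lt E r : r \in top lt E ->
  off lt E r = set0 ->
  top (merged lt (top lt E) r) E = top lt E /\ complete (merged lt (top lt E) r) E.
Proof.
move=> rtop off0.
have below z s : z \in E :\: top lt E -> s \in top lt E ->
    merged lt (top lt E) r z s.
  move=> zE stop; rewrite /merged /merge stop.
  have /setDP[_ /negbTE ->] := zE.
  apply: contraT => nlt; have : z \in off lt E r by rewrite inE zE.
  by rewrite off0 inE.
have e : top (merged lt (top lt E) r) E = top lt E.
  apply/eqP; rewrite eqEsubset top_merged // andbT; apply/subsetP => z /topP[zE zmax].
  apply: contraT => nz; have := zmax r (subsetP (top_sub lt E) r rtop).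
  by rewrite below // inE nz.
split=> //; apply/completeP; rewrite e => z s zE stop; exact: below.
Qed.

(** A point [z] not below [r] is below no point of [top lt E] after merging, so [z] or a maximal
    point over it is newly maximal. This makes the inductions on [n - #|top lt E|] terminate. *)
Lemma top_merged_lt lt E r : transitive lt -> irreflexive lt -> r \in top lt E ->
  off lt E r != set0 -> #|top lt E| < #|top (merged lt (top lt E) r) E|.
Proof.
move=> tr irr rtop /set0Pn[z zoff]; apply: proper_card.
apply/properP; split; first exact: top_merged.
pose mx := merged lt (top lt E) r.
case: (boolP (z \in top mx E)) => [ztop|nz].
  by exists z => //; move: zoff; rewrite inE => /andP[/setDP[]].
move: zoff; rewrite inE => /andP[zE nzr].
have /setDP[zE' zR] := zE.
have [w wtop lt_zw] : exists2 w, w \in top mx E & mx z w.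
  by apply: exists_top => //; [apply: merged_trans | apply: merged_irr].
exists w => //; apply/negP => wR; move: lt_zw.
by rewrite /mx /merged /merge (negPf zR) wR (negPf nzr).
Qed.

Lemma top_merged_complete lt E r : r \in top lt E -> complete (merged lt (top lt E) r) E ->
  top (merged lt (top lt E) r) E = top lt E :|: off lt E r.
Proof.
move=> rtop /completeP compl.
apply/eqP; rewrite eqEsubset subUset top_merged //=.
have stop := top_merged rtop.
apply/andP; split; apply/subsetP => z.
  move=> /topP[zE zmax]; rewrite inE; case: (boolP (z \in top lt E)) => //= nz.
  rewrite [_ \in off _ _ _]inE [_ \in _ :\: _]inE zE nz /=; have := zmax r (subsetP (top_sub lt E) r rtop).
  by rewrite /merged /merge (negPf nz) rtop.
rewrite inE => /andP[/setDP[zE nz] nzr]; apply: contraT => ntop.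
have := compl z r; rewrite inE ntop zE (subsetP stop) // /merged /merge rtop (negPf nz).
by move=> /(_ isT isT); rewrite (negPf nzr).
Qed.

Lemma top_neq0 lt E : transitive lt -> irreflexive lt -> E != set0 ->
  0 < #|top lt E|.
Proof.
move=> tr irr /set0Pn[x xE]; apply/card_gt0P.
case: (boolP (x \in top lt E)) => [xtop|nx]; first by exists x.
by have [r rtop _] := exists_top tr irr xE nx; exists r.
Qed.

Lemma cherries_complete_split lt E i : complete lt E ->
    #|top lt E| = #|E| - i -> i <= #|E| ->
  #|E :\: top lt E| = i /\
  cherries lt E = cherries lt (E :\: top lt E) + i * 'C(#|E| - i, l).
Proof.
move=> /completeP compl cardR le_i.
have cardE : #|E :\: top lt E| = i.
  by rewrite cardsD (setIidPr (top_sub lt E)) cardR subKn.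
split=> //; rewrite (cherries_complete (top_sub lt E) (@top_max lt E)) //.
by rewrite cardE cardR.
Qed.

(** Some merged poset does at least as well as the average. Merging either enlarges the set of
    maximal elements or makes the poset complete, and then the count is a split value by induction
    on the size. *)
Lemma cherries_ub lt E : transitive lt -> irreflexive lt ->
  cherries lt E <= max_count l #|E|.
Proof.
move def_n: #|E| => n; elim/ltn_ind: n lt E def_n => n IHn lt E def_n tr irr.
case: (eqVneq E set0) => [->|E_neq0]; first by rewrite /cherries big_set0.
move def_d: (n - #|top lt E|) => d.
elim/ltn_ind: d lt def_d tr irr => d IHd lt def_d tr irr.
have R_gt0 := top_neq0 tr irr E_neq0.
have le_Rn : #|top lt E| <= n by rewrite -def_n subset_leq_card ?top_sub.
rewrite -(leq_pmul2l R_gt0); apply: leq_trans (cherries_merge_le lt E) _.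
rewrite -sum_nat_const; apply: leq_sum => r rtop.
have trm : transitive (merged lt (top lt E) r) by exact: merged_trans.
have irrm : irreflexive (merged lt (top lt E) r) by exact: merged_irr.
case: (eqVneq (off lt E r) set0) => [off0|off_neq0]; last first.
  have := top_merged_lt tr irr rtop off_neq0.
  have : #|top (merged lt (top lt E) r) E| <= n.
    by rewrite -def_n subset_leq_card ?top_sub.
  by move=> le1 lt1; apply: (IHd _ _ _ (erefl _)) => //; lia.
have [etop compl] := top_merged_off0 rtop off0.
have [||cardE ->] := @cherries_complete_split _ _ (n - #|top lt E|) compl.
- by rewrite def_n etop subKn.
- by rewrite def_n leq_subr.
rewrite def_n; apply: leq_trans (_ : split_count l n (n - #|top lt E|) <= _); last first.
  by apply: split_count_le => //; apply: leq_subr.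
by rewrite leq_add2r; apply: IHn cardE _ _ => //; lia.
Qed.

(** * Stability: incomplete posets stay two below the maximum *)

Section Stability.

Variables (n k : nat).
Hypotheses (k_gt0 : 0 < k) (lt_kn : k + l < n).
Hypothesis margin : forall i, i < n -> i != k ->
  split_count l n i + 2 <= split_count l n k.

Lemma max_count_margin : max_count l n = split_count l n k.
Proof.
have [|j [lt_jn e _]] := @max_count_split l l_gt1 n; first by lia.
case: (eqVneq j k) e => [-> //|/(margin lt_jn) h e].
have := @split_count_le l l_gt1 n k ltac:(lia); lia.
Qed.

Lemma complete_margin lt E : transitive lt -> irreflexive lt -> #|E| = n ->
    complete lt E -> #|top lt E| != n - k ->
  cherries lt E + 2 <= split_count l n k.
Proof.
move=> tr irr cardE compl neq.
have top_gt0 : 0 < #|top lt E|.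
  by apply: top_neq0 => //; rewrite -card_gt0 cardE; lia.
have le_top : #|top lt E| <= n by rewrite -cardE subset_leq_card ?top_sub.
have [||cardD ->] := @cherries_complete_split _ _ (n - #|top lt E|) compl.
- by rewrite cardE subKn.
- by rewrite cardE leq_subr.
apply: leq_trans (margin (i := n - #|top lt E|) _ _); try lia.
rewrite leq_add2r cardE leq_add2r -cardD; exact: cherries_ub.
Qed.

Lemma link_partial lt R x B r s : r \in link lt R x B -> s \in R ->
  s \notin link lt R x B -> 0 < #|link lt R x B| < #|R|.
Proof.
move=> rL sR sL; apply/andP; split; first by apply/card_gt0P; exists r.
apply: proper_card; apply/properP; split; first exact: link_sub.
by exists s.
Qed.

Lemma card_off lt E r : r \in top lt E ->
    complete (merged lt (top lt E) r) E ->
    #|top (merged lt (top lt E) r) E| = n - k ->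
  #|off lt E r| = n - k - #|top lt E|.
Proof.
move=> rtop compl <-; rewrite top_merged_complete // cardsU.
have -> : top lt E :&: off lt E r = set0.
  apply/setP => z; rewrite [z \in _ :&: _]inE in_set0 [z \in off _ _ _]inE.
  by rewrite [z \in _ :\: _]inE; case: (z \in top lt E).
by rewrite cards0 subn0 addKn.
Qed.

(** One stem whose link is neither empty nor everything makes the averaging strict. If [off lt E r]
    is empty, the root [x] with empty stem has [r] but not [s] in its link. Otherwise points of
    [off lt E r] lie under some maximal element but not under [r], and serve as root ([l = 2]) or as
    stem ([l > 2]). *)
Lemma merge_gain lt E r x s : transitive lt -> irreflexive lt -> #|E| = n ->
    r \in top lt E -> complete (merged lt (top lt E) r) E ->
    #|top (merged lt (top lt E) r) E| = n - k ->
    x \in E :\: top lt E -> s \in top lt E -> ~~ lt x s ->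
  #|top lt E| * cherries lt E + #|top lt E|.-1 <=
    \sum_(t in top lt E) cherries (merged lt (top lt E) t) E.
Proof.
move=> tr irr cardE rtop compl cardtop xE stop nxs.
have cardoff := card_off rtop compl cardtop.
have etop := top_merged_complete rtop compl.
have offE z : z \in off lt E r -> z \in E :\: top lt E /\ ~~ lt z r.
  by rewrite inE => /andP.
have ntop z : z \in E :\: top lt E -> z \in top lt E = false.
  by rewrite inE => /andP[/negbTE].
have suff_gain y B : y \in E :\: top lt E -> stem lt (E :\: top lt E) y B ->
    0 < #|link lt (top lt E) y B| < #|top lt E| -> #|B| + 1 < l ->
    #|top lt E|.-1 <= 'C(#|top lt E|, l - #|B|) ->
    #|top lt E| * cherries lt E + #|top lt E|.-1 <=
      \sum_(t in top lt E) cherries (merged lt (top lt E) t) E.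
  move=> yE stB part cardB le_bin.
  by apply: leq_trans (cherries_merge_gain yE stB part cardB); rewrite leq_add2l.
have linkE y t B : t \in top lt E -> (t \in link lt (top lt E) y B) =
    lt y t && [forall b in B, ~~ lt b t].
  by move=> ttop; rewrite inE ttop.
have all0 t : [forall b in (set0 : {set T}), ~~ lt b t].
  by apply/forall_inP => b; rewrite inE.
case: (set_0Vmem (off lt E r)) => [off0|[z zoff]].
  apply: (suff_gain x set0 xE (stem0 _ _ _)); rewrite ?cards0 //.
    apply: (link_partial (r := r) (s := s)); rewrite ?linkE ?all0 ?andbT //.
    apply: contraT => nxr; have : x \in off lt E r by rewrite inE xE.
    by rewrite off0 inE.
  have [etop0 _] := top_merged_off0 rtop off0.
  move: cardtop; rewrite etop0 => cardtop.
  rewrite subn0; apply: leq_pred_bin => //; left; lia.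
have [zE nzr] := offE z zoff.
have [t ttop lt_zt] : exists2 t, t \in top lt E & lt z t.
  by have /setDP[zE' nz] := zE; apply: exists_top.
have top_gt1 : 1 < #|top lt E|.
  have -> : 1 = #|[set r]| by rewrite cards1.
  apply: proper_card; apply/properP; split; first by rewrite sub1set.
  by exists t => //; rewrite inE; apply: contraNN nzr => /eqP <-.
case: (ltnP 2 l) => [l_gt2|l_le2]; last first.
  have l_eq2 : l = 2 by apply/eqP; rewrite eqn_leq l_le2.
  apply: (suff_gain z set0 zE (stem0 _ _ _)); rewrite ?cards0 //.
    apply: (link_partial (r := t) (s := r)); rewrite ?linkE ?all0 ?andbT //.
  by rewrite subn0; apply: leq_pred_bin => //; right.
have off_gt0 : 0 < #|off lt E r| by apply/card_gt0P; exists z.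
(* Two points must be left to choose, hence [l - 2]. If [b = #|off lt E r|], then
   [l - b < #|top lt E|] follows from [n - k > l]. *)
pose b := minn #|off lt E r| (l - 2).
have [b_gt0 lt_bl bP] : [/\ 0 < b, b + 1 < l &
    l - b < #|top lt E| \/ l - b = 2 /\ 1 < #|top lt E|].
  rewrite /b; move: off_gt0 cardoff top_gt1; move: #|off lt E r| #|top lt E| => q m.
  by clear -k_gt0 lt_kn l_gt2 => *; split; lia.
have [B /andP[sBoff /eqP cardB]] : exists B : {set T}, (B \subset off lt E r) && (#|B| == b).
  have : 0 < #|[set B : {set T} | B \subset off lt E r & #|B| == b]|.
    by rewrite cards_draws bin_gt0 geq_minl.
  by case/card_gt0P => B; rewrite inE; exists B.
(* Since [k > 0], some non-maximal point is outside [off lt E r]; completeness of the merged poset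
   puts it below all of [off lt E r]. *)
have [y yE yoff] : exists2 y, y \in E :\: top lt E & y \notin off lt E r.
  have : ~~ (E :\: top lt E \subset off lt E r).
    apply/negP => /subset_leq_card; rewrite cardoff cardsD (setIidPr (top_sub lt E)).
    have : #|top lt E| <= n - k.
      by rewrite -cardtop etop subset_leq_card ?subsetUl.
    rewrite cardE; move: (#|top lt E|) => m; clear -k_gt0 lt_kn; lia.
  by case/subsetPn => y; exists y.
have lt_yr : lt y r by apply: contraNT yoff => nyr; rewrite inE yE.
have yntop : y \in top (merged lt (top lt E) r) E = false.
  by rewrite etop inE ntop // (negPf yoff).
have offtop w : w \in B -> w \in top (merged lt (top lt E) r) E.
  by move=> /(subsetP sBoff) woff; rewrite etop inE woff orbT.
have mergedE u v : u \in E :\: top lt E -> v \in E :\: top lt E ->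
    merged lt (top lt E) r u v = lt u v.
  by move=> uE vE; rewrite /merged /merge !ntop.
have BE w : w \in B -> w \in E :\: top lt E.
  by move=> /(subsetP sBoff)/offE[].
have [w wB] : exists w, w \in B by apply/card_gt0P; rewrite cardB.
have [wE nwr] := offE w (subsetP sBoff w wB).
have [v vtop lt_wv] : exists2 v, v \in top lt E & lt w v.
  by have /setDP[wE' nw] := wE; apply: exists_top.
apply: (suff_gain y B yE).
- apply/and4P; split; first by apply/subsetP.
  + by rewrite cardB; apply: leq_trans (leq_addr 1 b) (ltnW lt_bl).
  + apply/antichainP => u u' uB u'B; rewrite -mergedE ?BE //.
    have /topP[_] := offtop u uB; apply.
    by have /setDP[] := BE _ u'B.
  + apply/aboveP => u uB; rewrite -mergedE //; last exact: BE.
    have ytop : y \in E :\: top (merged lt (top lt E) r) E.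
      by rewrite inE yntop; have /setDP[] := yE.
    by have /completeP := compl; apply; rewrite ?offtop.
- apply: (link_partial (r := r) (s := v)); rewrite ?linkE //.
    rewrite lt_yr; apply/forall_inP => u /(subsetP sBoff).
    by case/offE.
  by rewrite negb_and negb_forall_in; apply/orP; right; apply/exists_inP;
    exists w; rewrite ?negbK.
- by rewrite cardB.
- by rewrite cardB; apply: leq_pred_bin => //; rewrite ltn_subRL.
Qed.

Lemma cherries_stable lt E : transitive lt -> irreflexive lt -> #|E| = n ->
  ~~ complete lt E -> cherries lt E + 2 <= split_count l n k.
Proof.
move def_d: (n - #|top lt E|) => d.
elim/ltn_ind: d lt def_d => d IHd lt def_d tr irr cardE.
rewrite /complete negb_forall_in => /exists_inP[x xE].
rewrite negb_forall_in => /exists_inP[s stop nxs].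
have trm r : transitive (merged lt (top lt E) r) by exact: merged_trans.
have irrm r : irreflexive (merged lt (top lt E) r) by exact: merged_irr.
(* Only merges of this shape can come within 1 of the maximum; the others are covered by
   [complete_margin] or by induction. *)
pose bad r := complete (merged lt (top lt E) r) E &&
  (#|top (merged lt (top lt E) r) E| == n - k).
have not_bad r : r \in top lt E -> ~~ bad r ->
    cherries (merged lt (top lt E) r) E + 2 <= split_count l n k.
  move=> rtop; rewrite negb_and.
  case: (boolP (complete (merged lt (top lt E) r) E)) => /= [compl|ncompl _].
    exact: complete_margin.
  apply: (IHd _ _ _ (erefl _)) => //.
  have off_neq0 : off lt E r != set0.
    apply: contraNneq ncompl => off0.
    by have [] := top_merged_off0 rtop off0.
  have := top_merged_lt tr irr rtop off_neq0.
  have : #|top (merged lt (top lt E) r) E| <= n.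
    by rewrite -cardE subset_leq_card ?top_sub.
  lia.
have top_gt0 : 0 < #|top lt E| by apply/card_gt0P; exists s.
have sum_le : \sum_(t in top lt E) cherries (merged lt (top lt E) t) E + 2 <=
    #|top lt E| * split_count l n k.
  (* If all were bad, all sets [off] would have equal size. But completeness after merging at [s]
     puts every non-maximal point outside [off lt E s] below [x], hence below [t], so [off lt E t]
     would be a proper subset of [off lt E s]. *)
  have [t ttop tnbad] : exists2 t, t \in top lt E & ~~ bad t.
    apply/exists_inP; rewrite -negb_forall_in; apply/negP => /forall_inP allbad.
    have xoff : x \in off lt E s by rewrite inE xE.
    have [t ttop lt_xt] : exists2 t, t \in top lt E & lt x t.
      by have /setDP[xE' nx] := xE; apply: exists_top.
    have /andP[compls /eqP cards] := allbad s stop.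
    have /andP[complt /eqP cardt] := allbad t ttop.
    have : off lt E t \proper off lt E s.
      apply/properP; split; last by exists x => //; rewrite inE lt_xt andbF.
      apply/subsetP => z; rewrite inE => /andP[zE nzt].
      apply: contraT => zoff.
      have /completeP/(_ z x) := compls.
      have /setDP[zE' nz] := zE; have /setDP[xE' nx] := xE.
      rewrite (top_merged_complete stop compls).
      rewrite [z \in _ :\: _]inE ![_ \in _ :|: _]inE (negPf nz) (negPf zoff) zE' xoff orbT.
      move=> /(_ isT isT); rewrite /merged /merge (negPf nz) (negPf nx) => lt_zx.
      by move: nzt; rewrite (tr _ _ _ lt_zx lt_xt).
    by move/proper_card; rewrite !card_off // ltnn.
  rewrite -sum_nat_const (bigD1 t) //= [X in _ <= X](bigD1 t) //= addnAC.
  apply: leq_add; first exact: not_bad.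
  apply: leq_sum => r _; rewrite -max_count_margin -cardE; exact: cherries_ub.
(* A bad merge gives slack [#|top lt E| - 1] and the good one saves 2, in total [#|top lt E| + 1];
   with no bad merge the saving is [2 * #|top lt E|]. After division the deficit is at least 2. *)
have : #|top lt E| * cherries lt E + #|top lt E| < #|top lt E| * split_count l n k.
  case: (boolP [forall r in top lt E, ~~ bad r]) => [/forall_inP allgood|].
    have : \sum_(t in top lt E) (cherries (merged lt (top lt E) t) E + 2) <=
        #|top lt E| * split_count l n k.
      by rewrite -sum_nat_const; apply: leq_sum => r rtop; apply: not_bad (allgood _ _).
    rewrite big_split /= sum_nat_const; have := cherries_merge_le lt E; lia.
  rewrite negb_forall_in => /exists_inP[r rtop]; rewrite negbK.
  move=> /andP[compl /eqP cardtop].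
  have := merge_gain tr irr cardE rtop compl cardtop xE stop nxs; lia.
by rewrite -mulnSr ltn_pmul2l // => ?; rewrite addn2.
Qed.

End Stability.

End PosetCount.

(** Stated for all posets, so that it applies to the points below the maximal ones. The successor
    form keeps it true when [max_count l n = 0]. *)
Definition missed_next_to_max l n := forall (T : finType) (lt : rel T) (E : {set T}),
  transitive lt -> irreflexive lt -> #|E| = n ->
  (cherries l lt E).+1 != max_count l n.

Lemma missed_next_to_max_small l n : 1 < l -> n <= l -> missed_next_to_max l n.
Proof. by move=> l_gt1 le_nl T lt E _ _ _; rewrite max_count0. Qed.

Lemma missed_next_to_max_step l n k : 1 < l -> 0 < k -> k + l < n ->
    (forall i, i < n -> i != k -> split_count l n i + 2 <= split_count l n k) ->
  missed_next_to_max l k -> missed_next_to_max l n.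
Proof.
move=> l_gt1 k_gt0 lt_kn margin missed T lt E tr irr cardE.
rewrite (max_count_margin l_gt1 k_gt0 lt_kn margin).
apply/eqP => e.
case: (boolP (complete lt E)) => [compl|ncompl]; last first.
  have := cherries_stable l_gt1 k_gt0 lt_kn margin tr irr cardE ncompl; lia.
case: (eqVneq #|top lt E| (n - k)) => [cardtop|neq]; last first.
  have := complete_margin l_gt1 k_gt0 lt_kn margin tr irr cardE compl neq; lia.
have [||cardD eD] := @cherries_complete_split _ _ l_gt1 lt E k compl.
- by rewrite cardE.
- by rewrite cardE; lia.
have /eqP := missed T lt _ tr irr cardD; apply.
by move: e; rewrite eD cardE /split_count; lia.
Qed.

(** * From permutations to posets *)

Definition northeast n (w : nat -> nat) : rel 'I_n := fun i j => (i < j) && (w i < w j).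

Lemma northeast_trans n w : transitive (@northeast n w).
Proof. by move=> j i k /andP[a b] /andP[c d]; rewrite /northeast (ltn_trans a c) (ltn_trans b d). Qed.

Lemma northeast_irr n w : irreflexive (@northeast n w).
Proof. by move=> i; rewrite /northeast ltnn. Qed.

Definition perm_word n (p : 'S_n) (i : nat) : nat :=
  if insub i is Some i' then p i' else 0.

Lemma perm_wordE n (p : 'S_n) (i : 'I_n) : perm_word p i = p i.
Proof. by rewrite /perm_word valK. Qed.

Lemma northeastE n (p : 'S_n) (i j : 'I_n) :
  northeast (perm_word p) i j = (i < j) && (p i < p j).
Proof. by rewrite /northeast !perm_wordE. Qed.

Lemma sorted_enum_ord n (A : {set 'I_n}) : sorted (relpre val ltn) (enum A).
Proof.
rewrite /enum_mem sorted_filter; first by [].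
  by move=> j i k; apply: ltn_trans.
by rewrite -sorted_map -enumT val_enum_ord iota_ltn_sorted.
Qed.

Variant ord_spec l : 'I_l.+1 -> Type :=
  | OrdZero : ord_spec ord0
  | OrdLift (i : 'I_l) : ord_spec (lift ord0 i).

Lemma ordP l (i : 'I_l.+1) : ord_spec i.
Proof. by case: (unliftP ord0 i) => [j ->|->]; constructor. Qed.

Section Copies.

Variables (l n : nat) (p : 'S_n).
Hypothesis l_gt1 : 1 < l.

Local Notation q := (pattern1rev l).
Local Notation lt := (@northeast n (perm_word p)).
Implicit Type f : {ffun 'I_l.+1 -> 'I_n}.

Lemma pattern1rev_lift (i : 'I_l) : q (lift ord0 i) = l - i :> nat.
Proof. by rewrite pattern1revE /= /bump /= add1n subSS. Qed.

Lemma pattern1rev0 : q ord0 = 0 :> nat.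
Proof. by rewrite pattern1revE. Qed.

Lemma occurrenceP f : reflect
  [/\ forall i j : 'I_l.+1, i < j -> f i < f j,
      forall j : 'I_l, p (f ord0) < p (f (lift ord0 j)) &
      forall i j : 'I_l, i < j -> p (f (lift ord0 j)) < p (f (lift ord0 i))]
  (occurrence q p f).
Proof.
apply: (iffP andP) => [[/forallP mono /forallP pat]|[mono low dec]].
  have {}mono (i j : 'I_l.+1) : i < j -> f i < f j.
    by move=> ltij; have /forallP/(_ j)/implyP := mono i; apply.
  have {}pat (i j : 'I_l.+1) : (p (f i) < p (f j)) = (q i < q j).
    by have /eqP := forallP (pat i) j.
  split=> // [j|i j ltij]; rewrite pat ?pattern1rev0 !pattern1rev_lift.
    by rewrite subn_gt0 ltn_ord.
  by have := ltn_ord j; lia.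
split; apply/forallP => i; apply/forallP => j; first by apply/implyP/mono.
apply/eqP; case: (ordP i) => [|i']; case: (ordP j) => [|j'].
- by rewrite !ltnn.
- by rewrite low pattern1rev0 pattern1rev_lift subn_gt0 ltn_ord.
- by rewrite pattern1rev0 ltn0; have := low i'; lia.
- rewrite !pattern1rev_lift; have := ltn_ord i'; have := ltn_ord j'.
  case: (ltngtP i' j') => [h|h|/val_inj ->]; last by rewrite !ltnn.
    by have := dec _ _ h; lia.
  by rewrite (dec _ _ h); lia.
Qed.

Definition cherry_of f := (f ord0, [set f (lift ord0 i) | i : 'I_l]).

Lemma cherry_of_inj : {in [set f | occurrence q p f] &, injective cherry_of}.
Proof.
move=> f g; rewrite !inE => /occurrenceP[fmono _ _] /occurrenceP[gmono _ _] [e0 eA].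
pose s (h : {ffun 'I_l.+1 -> 'I_n}) := [seq val (h (lift ord0 i)) | i <- enum 'I_l].
have s_sorted (h : {ffun 'I_l.+1 -> 'I_n}) : (forall i j : 'I_l.+1, i < j -> h i < h j) -> sorted ltn (s h).
  move=> mono; rewrite sorted_map.
  apply: (sub_sorted (e := relpre val ltn)) => [i j ltij|]; first exact: mono.
  by rewrite -sorted_map val_enum_ord iota_ltn_sorted.
have memE (h : {ffun 'I_l.+1 -> 'I_n}) (k : 'I_n) : (val k \in s h) = (k \in [set h (lift ord0 i) | i : 'I_l]).
  apply/mapP/imsetP => [[i _ /val_inj ->]|[i _ ->]]; exists i => //.
  by rewrite mem_enum.
(* Both are strictly increasing lists with the same members. *)
have : s f = s g.
  apply: (irr_sorted_eq ltn_trans ltnn (s_sorted f fmono) (s_sorted g gmono)) => k.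
  case: (ltnP k n) => [lt_kn|ge].
    by have := memE f (Ordinal lt_kn); have := memE g (Ordinal lt_kn); rewrite /= eA => -> ->.
  by apply/mapP/mapP => -[i _ e]; move: ge; rewrite e leqNgt ltn_ord.
move/eq_in_map => efg; apply/ffunP => i; case: (ordP i) => [|j] //.
by apply/val_inj/efg; rewrite mem_enum.
Qed.

Lemma copies_cherries : copies q p = cherries l lt setT.
Proof.
rewrite /copies -(card_in_imset cherry_of_inj) /cherries.
transitivity #|[set xA : 'I_n * {set 'I_n} | cherry l lt setT xA.1 xA.2]|; last first.
  rewrite -sum1dep_card -(pair_big_dep xpredT (cherry l lt setT) (fun _ _ => 1)) /=.
  by apply: eq_big => [x|x _]; rewrite ?inE // sum1dep_card.
apply: eq_card => -[x A]; rewrite inE /=.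
apply/imsetP/idP => [[f]|].
  rewrite inE => /occurrenceP[mono low dec] [-> ->].
  have fE (i j : 'I_l.+1) : (f i < f j) = (i < j).
    case: (ltngtP i j) => [/mono //|/mono h|/val_inj ->]; last by rewrite ltnn.
    by apply/negbTE; rewrite -leqNgt ltnW.
  apply/and4P; split; first exact: subsetT.
  - rewrite card_imset ?card_ord // => i j e.
    apply/val_inj/eqP; rewrite eqn_leq.
    have := fE (lift ord0 i) (lift ord0 j); have := fE (lift ord0 j) (lift ord0 i).
    by rewrite e ltnn /= /bump /= !add1n !ltnS; lia.
  - apply/antichainP => _ _ /imsetP[i _ ->] /imsetP[j _ ->].
    rewrite northeastE fE /= /bump /= !add1n ltnS; apply/negP => /andP[ltij].
    by have := dec _ _ ltij; lia.
  - apply/aboveP => _ /imsetP[i _ ->].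
    by rewrite northeastE fE low.
case/and4P => _ /eqP cardA /antichainP antiA /aboveP aboveA.
have size_s : size (enum A) = l by rewrite -cardE.
(* The root comes first, then [A] in the order of [enum], which is increasing in position. *)
pose f : {ffun 'I_l.+1 -> 'I_n} := [ffun i : 'I_l.+1 => if unlift ord0 i is Some j then nth x (enum A) j else x].
have f0 : f ord0 = x by rewrite ffunE unlift_none.
have fl i : f (lift ord0 i) = nth x (enum A) i by rewrite ffunE liftK.
have fA (i : 'I_l) : f (lift ord0 i) \in A.
  by rewrite fl -mem_enum mem_nth // size_s.
have fmono (i j : 'I_l) : i < j -> f (lift ord0 i) < f (lift ord0 j).
  rewrite !fl => ltij.
  apply: (sorted_ltn_nth (leT := relpre val ltn)) => //; rewrite ?inE ?size_s //.
    by move=> b a c; apply: ltn_trans.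
  exact: sorted_enum_ord.
exists f.
  rewrite inE; apply/occurrenceP; split=> [i j|j|i j ltij].
  - case: (ordP i) => [|i']; case: (ordP j) => [|j'] //.
      by move=> _; have := aboveA _ (fA j'); rewrite f0 northeastE => /andP[].
    by rewrite /= /bump /= !add1n ltnS => /fmono.
  - by have := aboveA _ (fA j); rewrite f0 northeastE => /andP[].
  - have := antiA _ _ (fA i) (fA j); rewrite northeastE fmono //= -leqNgt.
    rewrite leq_eqVlt => /orP[/eqP/val_inj/perm_inj e|//].
    by have := fmono _ _ ltij; rewrite e ltnn.
rewrite /cherry_of f0; congr pair; apply/setP => a; apply/idP/imsetP => [aA|[i _ ->]] //.
have lt_il : index a (enum A) < l by rewrite -size_s index_mem mem_enum.
by exists (Ordinal lt_il) => //; rewrite fl /= nth_index ?mem_enum.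
Qed.

End Copies.

(** * Layered permutations reach the optimum, and the internal zero follows *)

Lemma eq_cherries (T : finType) l (lt lt' : rel T) (E : {set T}) :
  {in E &, lt =2 lt'} -> cherries l lt E = cherries l lt' E.
Proof.
move=> e; apply: eq_bigr => x xE; apply: eq_card => A; rewrite !inE /cherry.
case sAE: (A \subset E) => //=; congr [&& _, _ & _].
  by apply/antichainP/antichainP => h a b aA bA; have := h a b aA bA;
    rewrite e // (subsetP sAE).
by apply/aboveP/aboveP => h a aA; have := h a aA; rewrite e // (subsetP sAE).
Qed.

Lemma card_ord_lt N n : n <= N -> #|[set i : 'I_N | i < n]| = n.
Proof.
move=> le_nN; rewrite -sum1dep_card (big_ord_narrow le_nN).
by rewrite sum1_card card_ord.
Qed.

Lemma max_count_word l N n : 1 < l -> n <= N -> exists w : nat -> nat,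
  [/\ forall i, i < n -> w i < n, {in gtn n &, injective w} &
      cherries l (@northeast N w) [set i : 'I_N | i < n] = max_count l n].
Proof.
move=> l_gt1; elim/ltn_ind: n => n IH le_nN.
case: (posnP n) => [->|n_gt0].
  exists id; split=> //; rewrite /cherries big1 // => i; by rewrite inE.
have [j [lt_jn Mn _]] := max_count_split l_gt1 n_gt0.
have [w [w_lt w_inj cw]] := IH j lt_jn ltac:(lia).
(* The last layer takes the values from [n.-1] down to [j], above everything before it. *)
pose w' i := if i < j then w i else n.-1 - (i - j).
exists w'; split=> [i lt_in|a b|].
- rewrite /w'; case: (ltnP i j) => h; last by lia.
  by have := w_lt i h; lia.
- rewrite !inE /w' => an bn; case: (ltnP a j) => ha; case: (ltnP b j) => hb; last by lia.
  + by apply: w_inj; rewrite inE.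
  + by have := w_lt a ha; lia.
  + by have := w_lt b hb; lia.
pose R := [set i : 'I_N | j <= i < n].
rewrite (@cherries_complete _ l l_gt1 _ _ R).
- have -> : [set i : 'I_N | i < n] :\: R = [set i : 'I_N | i < j].
    by apply/setP => i; rewrite !inE; lia.
  have -> : #|R| = n - j.
    have := cardsID [set i : 'I_N | i < j] [set i : 'I_N | i < n].
    have -> : [set i : 'I_N | i < n] :\: [set i : 'I_N | i < j] = R.
      by apply/setP => i; rewrite !inE; lia.
    have -> : [set i : 'I_N | i < n] :&: [set i : 'I_N | i < j] = [set i : 'I_N | i < j].
      by apply/setP => i; rewrite !inE; lia.
    by rewrite !card_ord_lt; lia.
  rewrite card_ord_lt; last by lia.
  rewrite Mn /split_count -cw; congr addn; apply: eq_cherries => a b.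
  by rewrite !inE /northeast /w' => -> ->.
- by apply/subsetP => i; rewrite !inE => /andP[].
- move=> r y; rewrite !inE /northeast /w' => /andP[r1 r2] yn.
  by rewrite (ltnNge r j) r1 /=; case: (ltnP y j) => h; lia.
- move=> x r; rewrite !inE /northeast /w' => xE /andP[r1 r2].
  have lt_xj : x < j by lia.
  rewrite lt_xj (ltnNge r j) r1 /=; have := w_lt _ lt_xj; lia.
Qed.

Lemma max_count_copies l n : 1 < l ->
  exists p : 'S_n, copies (pattern1rev l) p = max_count l n.
Proof.
move=> l_gt1; have [w [w_lt w_inj cw]] := max_count_word l_gt1 (leqnn n).
pose g (i : 'I_n) := Ordinal (w_lt i (ltn_ord i)).
have g_inj : injective g.
  by move=> i j [] /w_inj e; apply/val_inj/e; rewrite inE.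
exists (perm g_inj); rewrite copies_cherries //; apply: etrans cw.
have -> : [set i : 'I_n | i < n] = setT.
  by apply/setP => i; rewrite !inE ltn_ord.
by apply: eq_cherries => i j _ _; rewrite northeastE !permE.
Qed.

Lemma copies_perm1 l n : 1 < l -> copies (pattern1rev l) (1%g : 'S_n) = 0.
Proof.
move=> l_gt1; rewrite copies_cherries // /cherries big1 // => x _.
apply/eqP; rewrite cards_eq0; apply/eqP/setP => A; rewrite !inE.
apply/negP => /and4P[_ /eqP cardA /antichainP antiA _].
have /card_gt1P[a [b [aA bA]]] : 1 < #|A| by rewrite cardA.
have := antiA a b aA bA; have := antiA b a bA aA.
rewrite !northeastE !perm1 !andbb -val_eqE /=; lia.
Qed.

Lemma freq_neq0 k n (q : 'S_k) (p : 'S_n) : freq n q (copies q p) <> 0.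
Proof.
by apply/eqP; rewrite cards_eq0; apply/set0Pn; exists p; rewrite inE.
Qed.

(** The neighbours are 0, from the identity, and the maximum, from a layered permutation;
    [1 < max_count l n] keeps 0 strictly below the missed value. *)
Lemma internal_zero_missed l n : 1 < l -> 1 < max_count l n ->
  missed_next_to_max l n -> internal_zero (@freq l.+1 n (pattern1rev l)) (max_count l n).-1.
Proof.
move=> l_gt1 M_gt1 missed; split.
  apply/eqP; rewrite cards_eq0; apply/eqP/setP => p; rewrite !inE copies_cherries //.
  have := missed _ _ [set: 'I_n] (@northeast_trans n (perm_word p))
    (@northeast_irr n (perm_word p)).
  rewrite cardsT card_ord => /(_ erefl)/eqP missed_p.
  by apply/negbTE/eqP => e; apply: missed_p; rewrite e prednK // ltnW.
have [p cp] := max_count_copies n l_gt1.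
exists 0, (max_count l n); split; first by lia.
split; last by rewrite -cp; apply: freq_neq0.
by have := @freq_neq0 _ n (pattern1rev l) 1%g; rewrite copies_perm1.
Qed.

Lemma missed_next_to_max_start l : 1 < l ->
  exists k, [/\ l <= k, l = 2 -> 6 <= k & missed_next_to_max l k].
Proof.
move=> l_gt1; case: (ltnP 2 l) => [l_gt2|l_le2].
  by exists l; split=> //; [lia | apply: missed_next_to_max_small].
have -> : l = 2 by lia.
(* [split_margin] does not reach down to [k = 2]; at [n = 6] the values
   [split_count 2 6 i] are [0, 10, 12, 10, 7, 6]. *)
exists 6; split=> //.
apply: (@missed_next_to_max_step 2 6 2) => //.
by do 6 case=> //.
Qed.

Theorem theorem7p11 (l : nat) (hl : 2 <= l) :
  forall N : nat, exists n : nat, N < n /\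
    exists c : nat, internal_zero (@freq l.+1 n (pattern1rev l)) c.
Proof.
move=> N.
have [k [le_Nk le_lk l2 missed]] :
    exists k, [/\ N <= k, l <= k, l = 2 -> 6 <= k & missed_next_to_max l k].
  elim: N => [|N [k [le_Nk le_lk l2 missed]]].
    by have [k [le_lk l2 missed]] := missed_next_to_max_start hl; exists k.
  have [n [lt_kn margin]] := split_margin hl le_lk l2.
  exists n; split; try lia.
  by apply: (missed_next_to_max_step hl _ lt_kn margin missed); lia.
have [n [lt_kn margin]] := split_margin hl le_lk l2.
have k_gt0 : 0 < k by lia.
exists n; split; first by lia.
exists (max_count l n).-1; apply: internal_zero_missed => //.
  rewrite (max_count_margin hl k_gt0 lt_kn margin).
  (* The margin over the split at 0 already forces a maximum of at least 2. *)
  by have := margin 0; lia.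
exact: (missed_next_to_max_step hl k_gt0 lt_kn margin missed).
Qed.
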